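(* Let $n\ge 1$ and let $S=\begin{pmatrix} A & B\\ C & D\end{pmatrix}\in SP_{2n}(\mathbb{C})$ (with $n\times n$ blocks) be purely imaginary. Then the map $\Phi_S$, $\Phi_S(Z)=(AZ+B)(CZ+D)^{-1}$, is an isometry between the metric spaces $(\mathcal{S}_n,d_\infty)$ and $(\overline{\mathcal{S}}_n,d_-)$.
   Context: $J=\begin{pmatrix} O & I_n\\ -I_n & O\end{pmatrix}$, where $I_n$ and $O$ are the $n\times n$ identity and zero matrices. $SP_{2n}(\mathbb{C})$ is the group of complex $2n\times 2n$ matrices $S$ with $S^tJS=J$ (transpose, not conjugate transpose). $S$ is purely imaginary if $S=iQ$ for a real matrix $Q$. $\mathcal{S}_n$ is the set of complex $n\times n$ matrices $Z=X+iY$ with $X,Y$ real symmetric and $Y$ positive definite. $\overline{\mathcal{S}}_n$ is the set of complex $n\times n$ matrices $Z=X+iY$ with $X,Y$ real symmetric and $Y$ negative definite. For $Z=X+iY\in\mathcal{S}_n$ and a complex symmetric $n\times n$ matrix $W$ (a tangent vector at $Z$), put $F_Z(W)=\|Y^{-1/2}WY^{-1/2}\|$, where $\|\cdot\|$ is the operator norm. The metric $d_\infty$ on $\mathcal{S}_n$ is $$d_\infty(Z_1,Z_2)=\inf_{Z(t)}\int_0^1 F_{Z(t)}(\dot Z(t))\,dt,$$ the infimum being over all differentiable paths $Z(t)$, $t\in[0,1]$, in $\mathcal{S}_n$ joining $Z_1$ to $Z_2$. The metric $d_-$ on $\overline{\mathcal{S}}_n$ is $d_-(Z_1,Z_2)=d_\infty(\overline{Z}_1,\overline{Z}_2)$,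 where $\overline{Z}=X-iY\in\mathcal{S}_n$ is the entrywise complex conjugate of $Z=X+iY\in\overline{\mathcal{S}}_n$. *)

(* Defs.v *)
From HB Require Import structures.
From mathcomp Require Import all_boot all_order all_algebra.
From mathcomp Require Import all_classical all_reals all_analysis.
From mathcomp.real_closed Require Import complex.

Set Implicit Arguments.
Unset Strict Implicit.
Unset Printing Implicit Defensive.

Import Order.TTheory GRing.Theory Num.Theory.
Import numFieldNormedType.Exports.

Local Open Scope classical_set_scope.
Local Open Scope ring_scope.
Local Open Scope complex_scope.

Section matrices.
Context {R : realType}.

Definition cmx {m n : nat} (X : 'M[R]_(m, n)) : 'M[R[i]]_(m, n) :=
  map_mx (real_complex R) X.

Definition conjmx {m n : nat} (Z : 'M[R[i]]_(m, n)) : 'M[R[i]]_(m, n) :=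
  map_mx conjc Z.

Definition posdef {n : nat} (Y : 'M[R]_n) : Prop :=
  forall v : 'cV[R]_n, v != 0 -> 0 < (v^T *m Y *m v) 0 0.

Definition negdef {n : nat} (Y : 'M[R]_n) : Prop :=
  forall v : 'cV[R]_n, v != 0 -> (v^T *m Y *m v) 0 0 < 0.

(* The positive definite square root of Y; 0 if there is none, which does not
   happen for Y symmetric positive definite. *)
Definition sqrtmx {n : nat} (Y : 'M[R]_n) : 'M[R]_n :=
  xget 0 [set Q : 'M[R]_n | [/\ Q^T = Q, posdef Q & Q *m Q = Y]].

Definition l2norm {n : nat} (v : 'cV[R[i]]_n) : R :=
  Num.sqrt (\sum_(i < n) ComplexField.Normc.normc (v i 0) ^+ 2).

Definition opnorm {m n : nat} (M : 'M[R[i]]_(m, n)) : R :=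
  sup [set l2norm (M *m v) | v in [set v : 'cV[R[i]]_n | l2norm v <= 1]].

Definition Jmx (n : nat) : 'M[R[i]]_(n + n) :=
  block_mx 0 1%:M (- 1%:M) 0.

Definition symplectic {n : nat} (S : 'M[R[i]]_(n + n)) : Prop :=
  S^T *m Jmx n *m S = Jmx n.

Definition purely_imaginary {m n : nat} (S : 'M[R[i]]_(m, n)) : Prop :=
  exists Q : 'M[R]_(m, n), S = 'i%C *: cmx Q.

End matrices.

Section siegel.
Context {R : realType}.

Definition siegel {n : nat} : set 'M[R[i]]_n :=
  [set Z | exists X Y : 'M[R]_n,
    [/\ X^T = X, Y^T = Y, posdef Y & Z = cmx X + 'i%C *: cmx Y]].

Definition siegel_bar {n : nat} : set 'M[R[i]]_n :=
  [set Z | exists X Y : 'M[R]_n,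
    [/\ X^T = X, Y^T = Y, negdef Y & Z = cmx X + 'i%C *: cmx Y]].

Definition finsler {n : nat} (Z W : 'M[R[i]]_n) : R :=
  let Y := map_mx (@complex.Im R) Z in
  let P := cmx (invmx (sqrtmx Y)) in
  opnorm (P *m W *m P).

(* dZ is the derivative of Z on [0, 1], one-sided at the end points. The cast
   to numFieldType selects the usual topology of the complex numbers. *)
Definition derivative_on01 {n : nat} (Z dZ : R -> 'M[R[i]]_n) : Prop :=
  forall t : R, t \in `[0, 1] ->
    (((s - t)^-1)%:C *: (Z s - Z t) : 'M[(R[i] : numFieldType)]_n)
      @[s --> within `[0, 1]%classic t^'] -->
      (dZ t : 'M[(R[i] : numFieldType)]_n).

Definition siegel_path {n : nat} (Z1 Z2 : 'M[R[i]]_n)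
    (Z dZ : R -> 'M[R[i]]_n) : Prop :=
  [/\ forall t : R, t \in `[0, 1] -> siegel (Z t),
      derivative_on01 Z dZ, Z 0 = Z1 & Z 1 = Z2].

Definition path_length {n : nat} (Z dZ : R -> 'M[R[i]]_n) : \bar R :=
  (\int[lebesgue_measure]_(t in `[0%R, 1%R]) (finsler (Z t) (dZ t))%:E)%E.

Definition d_infty {n : nat} (Z1 Z2 : 'M[R[i]]_n) : \bar R :=
  ereal_inf [set L | exists Z dZ : R -> 'M[R[i]]_n,
    siegel_path Z1 Z2 Z dZ /\ L = path_length Z dZ].

Definition d_minus {n : nat} (Z1 Z2 : 'M[R[i]]_n) : \bar R :=
  d_infty (conjmx Z1) (conjmx Z2).

Definition isometry_between {T U : Type} (A : set T) (dA : T -> T -> \bar R)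
    (B : set U) (dB : U -> U -> \bar R) (f : T -> U) : Prop :=
  set_bij A B f /\
  forall x y : T, A x -> A y -> dB (f x) (f y) = dA x y.

End siegel.

Definition Phi {R : realType} {n : nat} (S : 'M[R[i]]_(n + n)) (Z : 'M[R[i]]_n) :
    'M[R[i]]_n :=
  (ulsubmx S *m Z + ursubmx S) *m invmx (dlsubmx S *m Z + drsubmx S).

(* Main.v *)
Require Import Defs.
From mathcomp Require Import all_boot all_order all_algebra.
From mathcomp Require Import all_classical all_reals all_analysis.
From mathcomp.real_closed Require Import complex.

(** Put M(Z) = C Z + D and W(Z) = (A Z + B) M(Z)^-1, so that S maps the column
    block (Z, 1) to (W, 1) M. Evaluating the symplectic form on two such column
    blocks gives, for symmetric Z1, the identity
      W(Z1)^T - W(Z2) = M(Z1)^-T (Z1 - Z2) M(Z2)^-1,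
    which is the source of everything else.

    - With Z1 = Z2 it says that W is symmetric; dividing by s - t along a path
      it gives the derivative M^-T dZ M^-1 of W, with no differentiation of a
      quotient ([Phi_sub], [derivative_on01_cj_Phi]).
    - S purely imaginary means conj S = - S. Conjugating one of the two column
      blocks therefore costs a sign, and with N = A Z + B the same evaluation of
      the form yields M^H N - N^H M = conj Z - Z ([numer_denom_adj]). A kernel
      vector of M would be isotropic for Im Z, so M is invertible, and
      M^H Im(conj W) M = Im Z ([immx_Phi]): W lies in the lower half space, and
      Im Z and Im(conj W) are congruent.
    - If P and P' are the inverse square roots of Im Z and Im(conj W), then
      U = P^-1 M^-1 P' is unitary and P' M^-T dZ M^-1 P' = U^T (P dZ P) U, so
      that the Finsler norm is preserved ([finsler_congr]).

    So Z |-> conj (Phi S Z) maps paths in the Siegel space to paths of the same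
    length and does not increase d_infty. The inverse of S is again symplectic
    and purely imaginary, and induces the inverse map because conjugation
    commutes with Phi S; applying the inequality to both maps gives the
    isometry. *)

Set Implicit Arguments.
Unset Strict Implicit.
Unset Printing Implicit Defensive.

Import Order.TTheory GRing.Theory Num.Theory.
Import numFieldNormedType.Exports.

Local Open Scope classical_set_scope.
Local Open Scope ring_scope.
Local Open Scope complex_scope.

Local Notation cj := (map_mx conjc).

Definition adjmx {R : realType} {m n} (M : 'M[R[i]]_(m, n)) : 'M[R[i]]_(n, m) :=
  (cj M)^T.
Local Notation "M ^H" := (adjmx M) (at level 8, format "M ^H").

(** * Hermitian forms and square roots of real positive definite matrices *)

Section Algebra.
Context {R : realType}.
Local Notation C := R[i].

Definition immx {m n} (M : 'M[C]_(m, n)) : 'M[R]_(m, n) := map_mx (@complex.Im R) M.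
Definition remx {m n} (M : 'M[C]_(m, n)) : 'M[R]_(m, n) := map_mx (@complex.Re R) M.

Lemma adjmxM m n p (A : 'M[C]_(m, n)) (B : 'M[C]_(n, p)) :
  (A *m B)^H = B^H *m A^H.
Proof. by rewrite /adjmx map_mxM trmx_mul. Qed.

Lemma cjK m n : involutive (fun M : 'M[C]_(m, n) => cj M).
Proof. by move=> M; apply/matrixP=> i j; rewrite !mxE conjcK. Qed.

Lemma adjmxK m n (A : 'M[C]_(m, n)) : A^H^H = A.
Proof. by apply/matrixP=> i j; rewrite !mxE conjcK. Qed.

Lemma cj_cmx m n (A : 'M[R]_(m, n)) : cj (cmx A) = cmx A.
Proof. by apply/matrixP=> i j; rewrite !mxE conjc_real. Qed.

Lemma adjmx_cmx m n (A : 'M[R]_(m, n)) : (cmx A)^H = cmx A^T.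
Proof. by rewrite /adjmx cj_cmx /cmx map_trmx. Qed.

Lemma rect_mx m n (M : 'M[C]_(m, n)) : M = cmx (remx M) + 'i%C *: cmx (immx M).
Proof. by apply/matrixP=> i j; rewrite !mxE -complexE. Qed.

Lemma remx_rect m n (X Y : 'M[R]_(m, n)) : remx (cmx X + 'i%C *: cmx Y) = X.
Proof. by apply/matrixP=> i j; rewrite !mxE /=; simpc. Qed.

Lemma immx_rect m n (X Y : 'M[R]_(m, n)) : immx (cmx X + 'i%C *: cmx Y) = Y.
Proof. by apply/matrixP=> i j; rewrite !mxE /=; simpc. Qed.

Lemma cmxM m n p (A : 'M[R]_(m, n)) (B : 'M[R]_(n, p)) :
  cmx (A *m B) = cmx A *m cmx B.
Proof. exact: map_mxM. Qed.

Lemma subcj m n (M : 'M[C]_(m, n)) : M - cj M = (2%:R * 'i%C) *: cmx (immx M).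
Proof. by apply/matrixP=> i j; rewrite !mxE subcJ mulrAC. Qed.

(** The order on R[i] makes 0 < z say that z is real and positive, so this is
    positivity of the form together with its reality on the diagonal. *)
Definition hposdef {n} (H : 'M[C]_n) : Prop :=
  forall u : 'cV[C]_n, u != 0 -> 0 < (u^H *m H *m u) 0 0.

Lemma cmx_eq0 m n (A : 'M[R]_(m, n)) : (cmx A == 0) = (A == 0).
Proof. exact: map_mx_eq0. Qed.

(** For u = a + i b the cross terms of the form cancel because Y is symmetric,
    which leaves the value at a plus the value at b. *)
Lemma hposdef_cmx n (Y : 'M[R]_n) : Y^T = Y -> posdef Y -> hposdef (cmx Y).
Proof.
move=> symY posY u u0.
set a := remx u; set b := immx u.
have -> : u^H *m cmx Y *m u = cmx (a^T *m Y *m a + b^T *m Y *m b).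
  rewrite (rect_mx u) -/a -/b.
  have -> : (cmx a + 'i%C *: cmx b)^H = cmx a^T - 'i%C *: cmx b^T.
    apply/matrixP=> i j; rewrite !mxE /=; simpc => //.
  rewrite mulmxBl mulmxDr !mulmxBl -!scalemxAl -!scalemxAr -!cmxM scalerA.
  have -> : 'i%C * 'i%C = -1 :> C by rewrite -expr2 sqr_i.
  have -> : b^T *m Y *m a = a^T *m Y *m b.
    apply/matrixP=> i j; rewrite !ord1.
    have -> : b^T *m Y *m a = (a^T *m Y *m b)^T.
      by rewrite !trmx_mul trmxK symY mulmxA.
    by rewrite mxE.
  by rewrite scaleN1r opprK addrA subrK /cmx map_mxD.
rewrite mxE ltcR mxE.
have ge0 (w : 'cV[R]_n) : 0 <= (w^T *m Y *m w) 0 0.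
  by have [->|w0] := eqVneq w 0; [rewrite mulmx0 mxE|apply/ltW; exact: posY].
have [a0|a0] := eqVneq a 0; last exact: ltr_wpDr (ge0 _) (posY _ a0).
apply: ltr_wpDl => //; apply: posY; apply: contraNneq u0 => b0.
by rewrite (rect_mx u) -/a -/b a0 b0 /cmx !map_mx0 scaler0 addr0.
Qed.

Lemma posdef_remx n (H : 'M[C]_n) : hposdef H -> posdef (remx H).
Proof.
move=> posH v v0.
have := posH (cmx v); rewrite cmx_eq0 => /(_ v0).
rewrite adjmx_cmx {1}(rect_mx H) mulmxDr mulmxDl -scalemxAr -scalemxAl -!cmxM.
by rewrite !mxE ltcE => /andP[_]; rewrite /=; simpc.
Qed.

Lemma hposdef_congr n (H M : 'M[C]_n) : M \in unitmx -> hposdef H ->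
  hposdef (M^H *m H *m M).
Proof.
move=> uM posH u u0; rewrite !mulmxA -adjmxM -mulmxA; apply: posH.
by apply: contraNneq u0 => Mu0; rewrite -(mulKmx uM u) Mu0 mulmx0.
Qed.

Lemma hposdef_diag n (d : 'rV[R]_n) : (forall i, 0 < d 0 i) ->
  hposdef (diag_mx (cmx d)).
Proof.
move=> d0 u u0; rewrite mul_mx_diag mxE.
have term i : (\matrix_(i, j) (u^H i j * cmx d 0 j)) 0 i * u i 0 =
    (d 0 i)%:C * `|u i 0| ^+ 2.
  by rewrite !mxE sqr_normc mulrAC mulrC; congr (_ * _); rewrite mulrC.
have ge0 i : 0 <= (\matrix_(i, j) (u^H i j * cmx d 0 j)) 0 i * u i 0.
  by rewrite term mulr_ge0 ?exprn_ge0// ler0c ltW.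
have [i ui] : exists i, u i 0 != 0.
  apply/existsP; apply: contraNT u0 => /existsPn u0.
  by apply/eqP/colP => i; rewrite mxE; apply/eqP; have := u0 i; rewrite negbK.
rewrite (bigD1 i)//=; apply: ltr_wpDr; first exact: sumr_ge0.
by rewrite term mulr_gt0 ?exprn_gt0 ?normr_gt0// ltcR.
Qed.

Lemma unitmx_colP (F : fieldType) n (M : 'M[F]_n) :
  (forall v : 'cV[F]_n, M *m v = 0 -> v = 0) -> M \in unitmx.
Proof.
move=> inj; rewrite -unitmx_tr -row_free_unit -kermx_eq0; apply/rowV0P => v.
move/sub_kermxP => vM; apply: trmx_inj; rewrite trmx0; apply: inj.
by apply: trmx_inj; rewrite trmx_mul trmxK trmx0.
Qed.

Lemma posdef_unitmx n (Y : 'M[R]_n) : posdef Y -> Y \in unitmx.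
Proof.
move=> posY; apply: unitmx_colP => v Yv0; apply/eqP.
by apply/negPn/negP => v0; have := posY _ v0; rewrite -mulmxA Yv0 mulmx0 mxE ltxx.
Qed.

Lemma hposdef_diag_gt0 n (H : 'M[C]_n) i : hposdef H -> 0 < H i i.
Proof.
move=> /(_ (delta_mx i 0)); set e := delta_mx i 0.
have -> : e^H = delta_mx 0 i.
  by apply/matrixP => j k; rewrite !mxE andbC rmorph_nat.
rewrite -rowE -colE !mxE; apply; apply/eqP => /matrixP/(_ i 0).
by rewrite !mxE !eqxx => /eqP; rewrite oner_eq0.
Qed.

(** The spectral theorem provides a complex Hermitian positive definite square
    root H = A + i B of Y. Since Y is real, A and B anticommute, and B is
    antisymmetric; then tr (B^T A B) equals its own opposite, and positivity of
    A forces B = 0, so that H is real. *)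
Lemma posdef_sqrt n (Y : 'M[R]_n) : Y^T = Y -> posdef Y ->
  exists Q : 'M[R]_n, [/\ Q^T = Q, posdef Q & Q *m Q = Y].
Proof.
move=> symY posY.
have hY : (cmx Y)^H = cmx Y by rewrite adjmx_cmx symY.
have hY' : map_mx Num.conj (cmx Y)^T = cmx Y by rewrite -map_trmx.
have /orthomx_spectralP : cmx Y \is normalmx.
  by apply/normalmxP; rewrite hY'.
set U := spectralmx _; set d := spectral_diag _.
have uU : U \in unitmx := spectral_unit _.
have -> : invmx U = U^H.
  by rewrite invmx_unitary ?spectral_unitarymx// -map_trmx.
have UU : U *m U^H = 1%:M.
  have /unitarymxP := spectral_unitarymx (cmx Y).
  by rewrite -map_trmx.
move=> defY.
have dE : diag_mx d = U *m cmx Y *m U^H.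
  by rewrite {1}defY !mulmxA UU mul1mx -mulmxA UU mulmx1.
have uUH : U^H \in unitmx by case/mulmx1_unit: UU.
have posd i : 0 < d 0 i.
  have := hposdef_congr uUH (hposdef_cmx symY posY); rewrite adjmxK -dE.
  by move/(hposdef_diag_gt0 i); rewrite !mxE eqxx mulr1n.
pose r := \row_i Num.sqrt (complex.Re (d 0 i)).
have posr i : 0 < r 0 i.
  by rewrite mxE sqrtr_gt0; have := posd i; rewrite ltcE => /andP[].
pose H := U^H *m diag_mx (cmx r) *m U.
have hH : H^H = H.
  rewrite /H !adjmxM adjmxK mulmxA; congr (_ *m _ *m _).
  by rewrite /adjmx map_diag_mx tr_diag_mx cj_cmx.
have HH : H *m H = cmx Y.
  rewrite /H -!mulmxA (mulmxA U) UU mul1mx (mulmxA (diag_mx _)) defY mulmxA.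
  rewrite mulmx_diag; congr (U^H *m diag_mx _ *m U).
  apply/rowP => i; rewrite !mxE -rmorphM -expr2 sqr_sqrtr; last first.
    by have := posd i; rewrite ltcE => /andP[_ /ltW].
  exact: RRe_real (gtr0_real (posd i)).
have posH : hposdef H := hposdef_congr uU (hposdef_diag posr).
clearbody H.
have Hij i j : H i j = (H j i)^*%C by rewrite -{1}hH !mxE.
have symA : (remx H)^T = remx H.
  by apply/matrixP => i j; rewrite !mxE Hij; case: (H i j).
have symB : (immx H)^T = - immx H.
  by apply/matrixP => i j; rewrite !mxE Hij; case: (H i j).
have posA := posdef_remx posH.
have rH := rect_mx H; set A := remx H in symA rH posA *.
set B := immx H in symB rH *.
have HHE : cmx Y = cmx (A *m A - B *m B) + 'i%C *: cmx (A *m B + B *m A).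
  rewrite -HH rH mulmxDl !mulmxDr -!scalemxAl -!scalemxAr scalerA -!cmxM.
  have -> : 'i%C * 'i%C = -1 :> C by rewrite -expr2 sqr_i.
  rewrite scaleN1r /cmx map_mxB map_mxD scalerDr !addrA.
  by rewrite addrAC; congr (_ + _); rewrite addrAC.
have AABB : A *m A - B *m B = Y.
  rewrite -[LHS](remx_rect _ (A *m B + B *m A)) -HHE.
  by apply/matrixP => i j; rewrite !mxE.
(* The imaginary part of H H = Y vanishes. *)
have anti : B *m A = - (A *m B).
  apply/eqP; rewrite -addr_eq0 addrC -[_ + _](immx_rect (A *m A - B *m B)) -HHE.
  by apply/eqP/matrixP => i j; rewrite !mxE.
have trBAB : \tr (B^T *m A *m B) = 0.
  have : \tr (B *m A *m B) = - \tr (B *m A *m B).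
    by rewrite {1}anti mulNmx raddfN /= mxtrace_mulC mulmxA.
  move/eqP; rewrite -addr_eq0 -mulr2n mulrn_eq0 /= => /eqP tr0.
  by rewrite symB !mulNmx raddfN /= tr0 oppr0.
have quad j : (B^T *m A *m B) j j = ((col j B)^T *m A *m col j B) 0 0.
  rewrite tr_col -row_mul [LHS]mxE [RHS]mxE; apply: eq_bigr => k _.
  by rewrite [row _ _ _ _]mxE [col _ _ _ _]mxE.
have qge0 (v : 'cV[R]_n) : 0 <= (v^T *m A *m v) 0 0.
  by have [->|v0] := eqVneq v 0; [rewrite mulmx0 mxE|exact: ltW (posA v v0)].
have B0 : B = 0.
  apply/matrixP => i j; rewrite [RHS]mxE.
  have : (B^T *m A *m B) j j = 0.
    by apply: (psumr_eq0P _ trBAB) => // k _; rewrite quad.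
  rewrite quad => qj0.
  have colj : col j B = 0.
    by apply/eqP/negPn/negP => c0; have := posA _ c0; rewrite qj0 ltxx.
  by have := congr1 (fun v : 'cV_n => v i 0) colj; rewrite !mxE.
by exists A; split=> //; rewrite -AABB B0 mul0mx subr0.
Qed.

End Algebra.

(** * Invariance of the operator norm and of the Finsler norm *)

Section Norm.
Context {R : realType}.
Local Notation C := R[i].

Lemma sqrtmxP n (Y : 'M[R]_n) : Y^T = Y -> posdef Y ->
  [/\ (sqrtmx Y)^T = sqrtmx Y, sqrtmx Y \in unitmx
    & sqrtmx Y *m sqrtmx Y = Y].
Proof.
move=> symY posY; rewrite /sqrtmx.
by case: (xgetPex 0 (posdef_sqrt symY posY)) => symQ /posdef_unitmx uQ QQ.
Qed.

Lemma sum_normc_sqr n (v : 'cV[C]_n) :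
  (\sum_(i < n) ComplexField.Normc.normc (v i 0) ^+ 2)%:C = (v^H *m v) 0 0.
Proof.
rewrite mxE rmorph_sum; apply: eq_bigr => i _.
rewrite rmorphXn /= -[_%:C]/(`|v i 0|) sqr_normc mulrC; congr (_ * _).
by rewrite !mxE.
Qed.

Lemma l2norm_unitary n (U : 'M[C]_n) (v : 'cV[C]_n) :
  U^H *m U = 1%:M -> l2norm (U *m v) = l2norm v.
Proof.
move=> UU; congr Num.sqrt; apply: (@complexI R); rewrite !sum_normc_sqr.
by rewrite adjmxM mulmxA -(mulmxA _ _ U) UU mulmx1.
Qed.

Lemma l2norm_cj n (v : 'cV[C]_n) : l2norm (cj v) = l2norm v.
Proof.
congr Num.sqrt; apply: eq_bigr => i _; rewrite mxE.
by case: (v i 0) => a b /=; rewrite sqrrN.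
Qed.

Lemma opnorm_unitary n (U X V : 'M[C]_n) :
  U^H *m U = 1%:M -> V^H *m V = 1%:M -> opnorm (U *m X *m V) = opnorm X.
Proof.
move=> UU VV; have VV' : V *m V^H = 1%:M by exact: mulmx1C.
congr sup; apply/seteqP; split => x [v /= v1 <-].
  exists (V *m v); first by rewrite /= l2norm_unitary.
  by rewrite -!mulmxA (l2norm_unitary _ UU).
exists (V^H *m v); first by rewrite /= l2norm_unitary ?adjmxK.
by rewrite -!mulmxA (l2norm_unitary _ UU) (mulmxA V) VV' mul1mx.
Qed.

Lemma opnorm_cj n (X : 'M[C]_n) : opnorm (cj X) = opnorm X.
Proof.
congr sup; apply/seteqP; split => x [v /= v1 <-];
  exists (cj v); rewrite /= ?l2norm_cj//.
  by rewrite -l2norm_cj map_mxM cjK.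
by rewrite -map_mxM l2norm_cj.
Qed.

(** A congruence between the imaginary parts becomes, after extraction of the
    square roots Q and Q', a unitary matrix U = Q M^-1 Q'^-1. The left-hand
    side is the norm of U^T X U, where X is Q^-1 W Q^-1 and U^T is unitary as
    well; the conjugation goes away because Q' is real. *)
Lemma finsler_congr n (Z Z' W M : 'M[C]_n) :
  (immx Z)^T = immx Z -> posdef (immx Z) ->
  (immx Z')^T = immx Z' -> posdef (immx Z') ->
  M \in unitmx -> M^H *m cmx (immx Z') *m M = cmx (immx Z) ->
  finsler Z' (cj ((invmx M)^T *m W *m invmx M)) = finsler Z W.
Proof.
move=> symY posY symY' posY' uM.
rewrite /finsler -/(immx Z) -/(immx Z').
have [] := sqrtmxP symY posY; have [] := sqrtmxP symY' posY'.
set Q' := sqrtmx _ => symQ' uQ' <-; set Q := sqrtmx _ => symQ uQ <-.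
move=> MQ; set P := cmx (invmx Q); set P' := cmx (invmx Q').
have PQ : P *m cmx Q = 1%:M by rewrite -cmxM mulVmx// /cmx map_mx1.
have P'Q' : P' *m cmx Q' = 1%:M by rewrite -cmxM mulVmx// /cmx map_mx1.
have symP' : P'^T = P' by rewrite /P' /cmx map_trmx trmx_inv symQ'.
have adjP' : P'^H = P' by rewrite adjmx_cmx trmx_inv symQ'.
have adjQ : (cmx Q)^H = cmx Q by rewrite adjmx_cmx symQ.
have symcQ : (cmx Q)^T = cmx Q by rewrite /cmx map_trmx symQ.
pose U := cmx Q *m invmx M *m P'.
have UU : U^H *m U = 1%:M.
  rewrite /U !adjmxM adjP' adjQ -!mulmxA (mulmxA (cmx Q)) -cmxM -MQ.
  rewrite cmxM -!mulmxA (mulmxA (_^H) (M^H)) -adjmxM mulmxV//.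
  rewrite (mulKVmx uM) [_^H](_ : _ = 1%:M); last first.
    by rewrite /adjmx map_mx1 trmx1.
  by rewrite mul1mx (mulmxA P') P'Q' mul1mx; exact: mulmx1C.
have UTUT : U^T^H *m U^T = 1%:M.
  rewrite /adjmx -map_trmx trmxK.
  have := congr1 (fun X : 'M[C]_n => cj X) (mulmx1C UU).
  by rewrite map_mxM map_mx1 /adjmx -map_trmx cjK.
rewrite -[in LHS]opnorm_cj !map_mxM !cjK !cj_cmx.
rewrite -[RHS](opnorm_unitary _ UTUT UU) /U !trmx_mul symP' symcQ.
congr opnorm; rewrite !mulmxA.
rewrite -(mulmxA _ (cmx Q) P) (mulmx1C PQ) mulmx1.
by rewrite -(mulmxA _ P (cmx Q)) PQ mulmx1.
Qed.
End Norm.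

(** * The action of a purely imaginary symplectic matrix *)

Section Symplectic.
Context {R : realType} {n : nat}.
Local Notation C := R[i].
Implicit Types (S : 'M[C]_(n + n)) (Z : 'M[C]_n).

(** The blocks of S applied to the column block (Z, 1); see [mul_col_mx1]. *)
Definition numer S Z : 'M[C]_n := ulsubmx S *m Z + ursubmx S.
Definition denom S Z : 'M[C]_n := dlsubmx S *m Z + drsubmx S.

Lemma mul_col_mx1 S Z : S *m col_mx Z 1%:M = col_mx (numer S Z) (denom S Z).
Proof. by rewrite -{1}(submxK S) mul_block_col !mulmx1. Qed.

Lemma tr_col_Jmx (A B A' B' : 'M[C]_n) :
  (col_mx A B)^T *m Jmx n *m col_mx A' B' = A^T *m B' - B^T *m A'.
Proof.
rewrite tr_col_mx mul_row_block !mulmx0 mulmx1 mulmxN mulmx1 add0r addr0.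
by rewrite mul_row_col mulNmx addrC.
Qed.

(** Both sides are the symplectic form at the column blocks (Z1, 1) and (Z2, 1),
    the left one after applying S to them. *)
Lemma numer_denom S Z1 Z2 : symplectic S ->
  (numer S Z1)^T *m denom S Z2 - (denom S Z1)^T *m numer S Z2 = Z1^T - Z2.
Proof.
move=> symS; rewrite -tr_col_Jmx -!mul_col_mx1 trmx_mul -!mulmxA.
by rewrite (mulmxA S^T) (mulmxA (S^T *m _)) symS mulmxA tr_col_Jmx trmx1 mulmx1 mul1mx.
Qed.

Lemma siegelP Z : siegel Z <-> Z^T = Z /\ posdef (immx Z).
Proof.
split=> [[X [Y [symX symY posY ->]]]|[symZ posZ]].
  by rewrite immx_rect linearD linearZ /= /cmx !map_trmx symX symY.
by exists (remx Z), (immx Z); rewrite /remx /immx !map_trmx symZ -rect_mx.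
Qed.

Lemma immx_cj Z : immx (cj Z) = - immx Z.
Proof. by apply/matrixP => i j; rewrite !mxE; case: (Z i j). Qed.

Lemma siegel_barP Z : siegel_bar Z <-> siegel (cj Z).
Proof.
split=> [[X [Y [symX symY negY ->]]]|/siegelP[symZ posZ]].
  exists X, (- Y); split=> //; first by rewrite linearN /= symY.
    by move=> v v0; rewrite mulmxN mulNmx mxE oppr_gt0 negY.
  by apply/matrixP => i j; rewrite !mxE /=; simpc.
have {}symZ : Z^T = Z by rewrite -[in RHS](cjK Z) -symZ -map_trmx cjK.
exists (remx Z), (immx Z); rewrite /remx /immx !map_trmx symZ -rect_mx; split=> //.
by move=> v v0; have := posZ v v0; rewrite immx_cj mulmxN mulNmx mxE oppr_gt0.
Qed.

Lemma sym_subadj Z : Z^T = Z -> Z - Z^H = (2%:R * 'i%C) *: cmx (immx Z).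
Proof. by move=> symZ; rewrite /adjmx map_trmx symZ subcj. Qed.

Lemma twoi_neq0 : 2%:R * 'i%C != 0 :> C.
Proof. by rewrite mulf_neq0 ?pnatr_eq0// complexiE neq0Ci. Qed.

Lemma cj_imaginary (S : 'M[C]_(n + n)) : purely_imaginary S -> cj S = - S.
Proof.
move=> [Q ->]; apply/matrixP => i j; rewrite !mxE -mulNr [LHS]rmorphM.
by congr (_ * _); apply/eqP; rewrite eq_complex /= oppr0 !eqxx.
Qed.

Lemma numer_denom_cj S Z : cj S = - S ->
  cj (numer S Z) = - numer S (cj Z) /\ cj (denom S Z) = - denom S (cj Z).
Proof.
move=> cS; apply: eq_col_mx; rewrite -map_col_mx -mul_col_mx1 map_mxM cS.
by rewrite map_col_mx map_mx1 mulNmx mul_col_mx1 opp_col_mx.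
Qed.

(** The sesquilinear version of [numer_denom]: conjugating the first column
    block conjugates S, which only changes the sign. *)
Lemma numer_denom_adj S Z : symplectic S -> cj S = - S ->
  (denom S Z)^H *m numer S Z - (numer S Z)^H *m denom S Z = Z^H - Z.
Proof.
move=> symS cS; have [cN cD] := numer_denom_cj Z cS.
rewrite -(numer_denom _ _ symS) /adjmx cN cD.
by rewrite !linearN /= !mulNmx opprK addrC.
Qed.

(** A vector killed by the denominator is isotropic for the left-hand side of
    [numer_denom_adj], hence for the positive definite form Im Z. *)
Lemma denom_unit S Z : symplectic S -> cj S = - S -> siegel Z ->
  denom S Z \in unitmx.
Proof.
move=> symS cS /siegelP[symZ posZ]; apply: unitmx_colP => v Mv0.
have symY : (immx Z)^T = immx Z by rewrite /immx map_trmx symZ.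
apply/eqP/negPn/negP => /(hposdef_cmx symY posZ).
suff -> : v^H *m cmx (immx Z) *m v = 0 by rewrite mxE ltxx.
apply: (scalerI twoi_neq0); rewrite scaler0.
rewrite scalemxAl scalemxAr -sym_subadj// -opprB -(numer_denom_adj _ symS)//.
rewrite mulmxN mulNmx mulmxBr mulmxBl -!mulmxA Mv0 !mulmx0 subr0.
by rewrite mulmxA -adjmxM Mv0 /adjmx map_mx0 trmx0 mul0mx oppr0.
Qed.

Lemma PhiE S Z : Phi S Z = numer S Z *m invmx (denom S Z).
Proof. by []. Qed.

(** Unlike a quotient rule, this holds at two arbitrary points; symmetry of Phi
    and its derivative are both special cases. *)
Lemma Phi_sub S Z1 Z2 : symplectic S -> Z1^T = Z1 ->
  denom S Z1 \in unitmx -> denom S Z2 \in unitmx ->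
  (Phi S Z1)^T - Phi S Z2 =
    (invmx (denom S Z1))^T *m (Z1 - Z2) *m invmx (denom S Z2).
Proof.
move=> symS symZ u1 u2; rewrite -[X in _ *m (X - _) *m _]symZ -(numer_denom Z1 Z2 symS).
rewrite !PhiE; move: (numer S Z1) (numer S Z2) (denom S Z1) (denom S Z2) u1 u2.
move=> N1 N2 D1 D2 u1 u2; rewrite mulmxBr mulmxBl !mulmxA (mulmxK u2) trmx_mul.
have -> : (invmx D1)^T *m D1^T = 1%:M by rewrite -trmx_mul mulmxV ?trmx1.
by rewrite mul1mx.
Qed.

Lemma Phi_sym S Z : symplectic S -> Z^T = Z -> denom S Z \in unitmx ->
  (Phi S Z)^T = Phi S Z.
Proof.
move=> symS symZ uM; apply/eqP; rewrite -subr_eq0 Phi_sub// subrr.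
by rewrite mulmx0 mul0mx.
Qed.

Lemma immx_Phi S Z : symplectic S -> cj S = - S -> siegel Z ->
  (denom S Z)^H *m cmx (immx (cj (Phi S Z))) *m denom S Z = cmx (immx Z).
Proof.
move=> symS cS sZ; have uM := denom_unit symS cS sZ.
have /siegelP[symZ posZ] := sZ.
have symW := Phi_sym symS symZ uM.
apply: (scalerI twoi_neq0); rewrite -(sym_subadj symZ) -opprB.
rewrite -(numer_denom_adj Z symS cS) opprB scalemxAl scalemxAr -sym_subadj.
  have -> : (cj (Phi S Z))^H = Phi S Z by rewrite /adjmx cjK symW.
  have -> : cj (Phi S Z) = (Phi S Z)^H by rewrite /adjmx map_trmx symW.
  have -> : numer S Z = Phi S Z *m denom S Z by rewrite PhiE mulmxKV.
  by rewrite adjmxM mulmxBr mulmxBl !mulmxA.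
by rewrite map_trmx symW.
Qed.

Lemma siegel_cj_Phi S Z : symplectic S -> cj S = - S -> siegel Z ->
  siegel (cj (Phi S Z)).
Proof.
move=> symS cS sZ; have uM := denom_unit symS cS sZ.
have /siegelP[symZ posZ] := sZ.
have symW := Phi_sym symS symZ uM.
apply/siegelP; split; first by rewrite map_trmx symW.
have uM' : invmx (denom S Z) \in unitmx by rewrite unitmx_inv.
have symY : (immx Z)^T = immx Z by rewrite /immx map_trmx symZ.
have := posdef_remx (hposdef_congr uM' (hposdef_cmx symY posZ)).
rewrite -(immx_Phi symS cS sZ) !mulmxA -adjmxM mulmxV// -!mulmxA mulmxV// mulmx1.
rewrite /adjmx map_mx1 trmx1 mul1mx.
suff -> : forall Y : 'M[R]_n, remx (cmx Y) = Y by [].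
by move=> Y; apply/matrixP => i j; rewrite !mxE.
Qed.

(** S' sends (W, 1) to (Z, 1) M^-1, so the denominator of the second map is the
    inverse of that of the first. *)
Lemma Phi_invK S S' Z : S' *m S = 1%:M -> denom S Z \in unitmx ->
  Phi S' (Phi S Z) = Z.
Proof.
move=> S'S uM.
have : S' *m (S *m col_mx Z 1%:M) = col_mx Z 1%:M by rewrite mulmxA S'S mul1mx.
have -> : S *m col_mx Z 1%:M = col_mx (Phi S Z) 1%:M *m denom S Z.
  by rewrite mul_col_mx1 mul_col_mx mul1mx PhiE mulmxKV.
rewrite mulmxA mul_col_mx1 mul_col_mx => /eq_col_mx[eN eD].
have [uD _] := mulmx1_unit eD.
have -> : Phi S' (Phi S Z) = numer S' (Phi S Z) *m invmx (denom S' (Phi S Z)).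
  by [].
by rewrite -[invmx _]mulmx1 -eD mulKmx.
Qed.

(** The signs of the conjugated numerator and denominator cancel. *)
Lemma cj_Phi S Z : cj S = - S -> cj (Phi S Z) = Phi S (cj Z).
Proof.
move=> cS; have [cN cD] := numer_denom_cj Z cS.
rewrite !PhiE map_mxM map_invmx cN cD.
have invmxN (A : 'M[C]_n) : invmx (- A) = - invmx A.
  have [uA|nuA] := boolP (A \in unitmx).
    by rewrite -[- A]scaleN1r -[- invmx A]scaleN1r
      invmxZ ?unitmxZ ?unitrN1// invrN1.
  have nuNA : - A \notin unitmx by rewrite -[- A]scaleN1r unitmxZ ?unitrN1.
  by rewrite !invmx_out.
by rewrite invmxN mulNmx mulmxN opprK.
Qed.

(** From S^T J S = J and J J = - 1 the inverse is - J S^T J. *)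
Lemma symplectic_inv S : symplectic S -> 
  exists2 S', S' *m S = 1%:M & symplectic S' /\ (cj S = - S -> cj S' = - S').
Proof.
move=> symS.
have JJ : Jmx n *m Jmx n = - 1%:M :> 'M[C]_(n + n).
  rewrite /Jmx mulmx_block !(mul0mx, mulmx0, mul1mx, mulNmx, add0r, addr0).
  by rewrite [X in _ = - X]scalar_mx_block opp_block_mx !oppr0.
pose S' := - (Jmx n *m S^T *m Jmx n).
have S'S : S' *m S = 1%:M.
  by rewrite /S' mulNmx -!mulmxA (mulmxA S^T) symS JJ opprK.
exists S' => //; split.
  have SS' := mulmx1C S'S.
  rewrite /symplectic -symS.
  by rewrite !mulmxA -trmx_mul SS' trmx1 mul1mx -mulmxA SS' mulmx1 symS.
move=> cS; rewrite /S' map_mxN !map_mxM -map_trmx cS.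
have -> : cj (Jmx n) = Jmx n :> 'M[C]_(n + n).
  by rewrite /Jmx map_block_mx map_mxN map_mx1 map_mx0.
by rewrite linearN /= mulmxN mulNmx.
Qed.
End Symplectic.

(** * Limits of matrices and the derivative of the image of a path *)

Section MatrixLimits.
Context {K : numFieldType} {T : Type} (F : set_system T) {FF : Filter F}.

(** The neighbourhoods of a matrix are generated by products of neighbourhoods
    of its finitely many entries. *)
Lemma cvg_mx m n (f : T -> 'M[K]_(m, n)) (A : 'M[K]_(m, n)) :
  (forall i j, f x i j @[x --> F] --> A i j) -> f x @[x --> F] --> A.
Proof.
move=> fA B [P AP PB]; apply: (filterS PB).
have : \forall x \near F, forall ij : 'I_m * 'I_n, P ij.1 ij.2 (f x ij.1 ij.2).
  by apply: filter_forall => -[i j]; exact: fA (AP i j).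
by apply: filterS => x Px i j; exact: Px (i, j).
Qed.

Lemma cvg_mx_coord m n (f : T -> 'M[K]_(m, n)) (A : 'M[K]_(m, n)) i j :
  f x @[x --> F] --> A -> f x i j @[x --> F] --> A i j.
Proof.
by move=> fA P /(@coord_continuous K m n i j A) /fA.
Qed.

Lemma cvg_sumr I (r : seq I) (f : I -> T -> K) (a : I -> K) :
  (forall i, f i x @[x --> F] --> a i) ->
  \sum_(i <- r) f i x @[x --> F] --> \sum_(i <- r) a i.
Proof. by move=> fa; apply: cvg_big => //; exact: add_continuous. Qed.

Lemma cvg_prodr I (r : seq I) (f : I -> T -> K) (a : I -> K) :
  (forall i, f i x @[x --> F] --> a i) ->
  \prod_(i <- r) f i x @[x --> F] --> \prod_(i <- r) a i.
Proof. by move=> fa; apply: cvg_big => //; exact: mul_continuous. Qed.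

Lemma cvg_mulmx m n p (f : T -> 'M[K]_(m, n)) (g : T -> 'M[K]_(n, p))
    (A : 'M[K]_(m, n)) (B : 'M[K]_(n, p)) :
  f x @[x --> F] --> A -> g x @[x --> F] --> B ->
  f x *m g x @[x --> F] --> A *m B.
Proof.
move=> fA gB; apply: cvg_mx => i j; rewrite mxE; under eq_fun do rewrite mxE.
by apply: cvg_sumr => k; apply: cvgM; exact: cvg_mx_coord.
Qed.

Lemma cvg_trmx m n (f : T -> 'M[K]_(m, n)) (A : 'M[K]_(m, n)) :
  f x @[x --> F] --> A -> (f x)^T @[x --> F] --> A^T.
Proof.
move=> fA; apply: cvg_mx => i j; rewrite mxE; under eq_fun do rewrite mxE.
exact: cvg_mx_coord.
Qed.

Lemma cvg_det n (f : T -> 'M[K]_n) (A : 'M[K]_n) :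
  f x @[x --> F] --> A -> \det (f x) @[x --> F] --> \det A.
Proof.
move=> fA; apply: cvg_sumr => s; apply: cvgM; first exact: cvg_cst.
by apply: cvg_prodr => i; exact: cvg_mx_coord.
Qed.

Lemma cvg_adj n (f : T -> 'M[K]_n) (A : 'M[K]_n) :
  f x @[x --> F] --> A -> \adj (f x) @[x --> F] --> \adj A.
Proof.
move=> fA; apply: cvg_mx => i j; rewrite mxE; under eq_fun do rewrite mxE.
apply: cvgM; first exact: cvg_cst.
apply: cvg_det; apply: cvg_mx => k l; rewrite !mxE.
by under eq_fun do rewrite !mxE; exact: cvg_mx_coord.
Qed.

(** Cramer's rule expresses the inverse by the determinant and the adjugate,
    which are polynomial in the entries. *)
Lemma cvg_invmx n (f : T -> 'M[K]_n) (A : 'M[K]_n) : A \in unitmx ->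
  (\forall x \near F, f x \in unitmx) ->
  f x @[x --> F] --> A -> invmx (f x) @[x --> F] --> invmx A.
Proof.
move=> uA uf fA; rewrite /(invmx A) uA.
have : (\det (f x))^-1 *: \adj (f x) @[x --> F] --> (\det A)^-1 *: \adj A.
  apply: cvg_mx => i j; rewrite mxE; under eq_fun do rewrite mxE.
  apply: cvgM; last exact/cvg_mx_coord/cvg_adj.
  by apply: cvgV; [rewrite -unitfE -unitmxE|exact: cvg_det].
apply: cvg_trans; apply: near_eq_cvg.
by apply: filterS uf => x ux; rewrite /invmx ux.
Qed.

Lemma cvg_affine_mx m n p (f : T -> 'M[K]_(n, p)) (A : 'M[K]_(m, n)) B
    (Z : 'M[K]_(n, p)) :
  f x @[x --> F] --> Z -> A *m f x + B @[x --> F] --> A *m Z + B.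
Proof.
move=> fZ; apply: cvg_mx => i j; rewrite mxE; under eq_fun do rewrite mxE.
apply: cvgD; last exact: cvg_cst.
by apply: cvg_mx_coord; apply: cvg_mulmx fZ; exact: cvg_cst.
Qed.

Lemma cvg_congr_mx n (f g : T -> 'M[K]_n) (A B D : 'M[K]_n) :
  f x @[x --> F] --> A -> g x @[x --> F] --> D ->
  (f x)^T *m g x *m B @[x --> F] --> A^T *m D *m B.
Proof.
move=> fA gD; apply: cvg_mulmx; last exact: cvg_cst.
by apply: cvg_mulmx gD; exact: cvg_trmx.
Qed.
End MatrixLimits.

Section Derivative.
Context {R : realType}.
Local Notation C := (R[i] : numFieldType).

Lemma cvg_conjc {T} (F : set_system T) {FF : Filter F} (f : T -> C) (a : C) :
  f x @[x --> F] --> a -> ((f x)^*%C : C) @[x --> F] --> (a^*%C : C).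
Proof.
move=> /cvgrPdist_lt fa; apply/cvgrPdist_lt => e /fa.
by apply: filterS => x; rewrite -rmorphB normcJ.
Qed.

Lemma cvg_cjmx {T} (F : set_system T) {FF : Filter F} n (f : T -> 'M[C]_n)
    (A : 'M[C]_n) :
  f x @[x --> F] --> A -> (cj (f x) : 'M[C]_n) @[x --> F] --> (cj A : 'M[C]_n).
Proof.
move=> fA; apply: cvg_mx => i j; rewrite mxE; under eq_fun do rewrite mxE.
by apply: cvg_conjc; exact: cvg_mx_coord.
Qed.

Lemma cvg_real_complex {T} (F : set_system T) {FF : Filter F} (f : T -> R)
    (a : R) :
  f x @[x --> F] --> a -> ((f x)%:C : C) @[x --> F] --> (a%:C : C).
Proof.
move=> /cvgrPdist_lt fa; apply/cvgrPdist_lt => e e0.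
have eE : e = (complex.Re e)%:C by rewrite RRe_real// gtr0_real.
have {}e0 : 0 < complex.Re e by move: e0; rewrite eE ltcR.
have := fa _ e0; apply: filterS => x; rewrite -rmorphB normc_def /= expr0n addr0.
by rewrite sqrtr_sqr eE ltcR.
Qed.

(** By [Phi_sub], the difference quotient at s of the image is the difference
    quotient of Z framed by the inverse denominators at s and at t, so only the
    continuity of the inverse denominator has to be added. *)
Lemma derivative_on01_cj_Phi n (S : 'M[R[i]]_(n + n)) (Z dZ : R -> 'M[R[i]]_n) :
  symplectic S -> cj S = - S ->
  (forall t : R, t \in `[0, 1] -> siegel (Z t)) ->
  derivative_on01 Z dZ ->
  derivative_on01 (fun t => cj (Phi S (Z t)))
    (fun t => cj ((invmx (denom S (Z t)))^T *m dZ t *m invmx (denom S (Z t)))).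
Proof.
move=> symS cS sZ derZ t t01; have q := derZ t t01.
set F := within _ _ in q *.
have Fin : \forall s \near F, s \in `[0, 1] by exact: withinT.
have Fneq : \forall s \near F, s != t.
  apply: (@cvg_within _ t^' _ `[0, 1]%classic).
  exact: (@withinT _ (nbhs t) (fun s => s != t)).
have Ft : ((s - t)%:C : C) @[s --> F] --> (0 : C).
  have -> : 0 = (t - t)%:C :> C by rewrite subrr.
  apply: cvg_real_complex; apply: cvgB; last exact: cvg_cst.
  move=> P tP; apply: (@cvg_within _ t^' _ `[0, 1]%classic).
  exact: nbhs_dnbhs.
have FF : Filter F by exact: within_filter.
clearbody F.
(* Z is continuous at t, as Z s = Z t + (s - t) (difference quotient). *)
have ZF : (Z s : 'M[C]_n) @[s --> F] --> (Z t : 'M[C]_n).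
  apply: cvg_mx => i j.
  have : (Z t i j + (s - t)%:C * (((s - t)^-1)%:C *: (Z s - Z t)) i j : C)
      @[s --> F] --> (Z t i j + 0 * dZ t i j : C).
    apply: cvgD; first exact: cvg_cst.
    have qij := @cvg_mx_coord C _ F n n _ _ i j q.
    by apply: (cvgM Ft); exact: qij.
  rewrite mul0r addr0; apply: cvg_trans; apply: near_eq_cvg.
  apply: filterS Fneq => s st; rewrite mxE mulrA -rmorphM /= divff ?subr_eq0//.
  by rewrite mul1r !mxE [LHS]addrC; exact: subrK.
have MF : (denom S (Z s) : 'M[C]_n) @[s --> F] --> (denom S (Z t) : 'M[C]_n).
  exact: (@cvg_affine_mx C).
have uM s : s \in `[0, 1] -> denom S (Z s) \in unitmx.
  by move=> s01; exact: denom_unit (sZ s s01).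
have iF : (invmx (denom S (Z s)) : 'M[C]_n) @[s --> F]
    --> (invmx (denom S (Z t)) : 'M[C]_n).
  by apply: (@cvg_invmx C) MF; [exact: uM|apply: filterS Fin => s; exact: uM].
have dF := @cvg_congr_mx C _ F _ _ _ _ _ (invmx (denom S (Z t))) _ iF q.
have := @cvg_cjmx _ F FF n _ _ (dF FF).
apply: cvg_trans; apply: near_eq_cvg.
apply: filterS Fin => s s01; rewrite -scalemxAr -scalemxAl map_mxZ -map_mxB.
have /siegelP[symZs _] := sZ s s01.
rewrite -Phi_sub// ?uM// Phi_sym// ?uM//; congr (_ *: _).
exact: conjc_real.
Qed.
End Derivative.

(** * The isometry *)

Section Isometry.
Context {R : realType} {n : nat}.
Local Notation C := R[i].
Implicit Types (S : 'M[C]_(n + n)) (Z : 'M[C]_n).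

Lemma finsler_cj_Phi S Z W : symplectic S -> cj S = - S -> siegel Z ->
  finsler (cj (Phi S Z))
    (cj ((invmx (denom S Z))^T *m W *m invmx (denom S Z))) = finsler Z W.
Proof.
move=> symS cS sZ; have uM := denom_unit symS cS sZ.
have /siegelP[symZ posZ] := sZ.
have /siegelP[symV posV] := siegel_cj_Phi symS cS sZ.
by apply: finsler_congr uM (immx_Phi symS cS sZ) => //;
  rewrite /immx map_trmx ?symZ ?symV.
Qed.

(** The image of every admissible path is admissible and has the same length:
    the integrands agree at every point of [0, 1]. *)
Lemma d_infty_cj_Phi_le S Z1 Z2 : symplectic S -> cj S = - S ->
  (d_infty (cj (Phi S Z1)) (cj (Phi S Z2)) <= d_infty Z1 Z2)%E.
Proof.
move=> symS cS; apply: le_ereal_inf => L [Z [dZ [[sZ derZ Z0 Z1'] ->]]].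
exists (fun t => cj (Phi S (Z t))).
exists (fun t => cj ((invmx (denom S (Z t)))^T *m dZ t *m invmx (denom S (Z t)))).
split; first split.
- by move=> t t01; apply: siegel_cj_Phi (sZ t t01).
- exact: derivative_on01_cj_Phi.
- by rewrite Z0.
- by rewrite Z1'.
rewrite /path_length.
apply: (@eq_integral _ _ _ lebesgue_measure `[0, 1]%classic) => t /set_mem t01.
apply: congr1; apply: esym.
exact: finsler_cj_Phi symS cS (sZ t t01).
Qed.

(** Conjugation commutes with the action of S', so the two conjugations
    cancel. *)
Lemma cj_PhiK S S' Z : S' *m S = 1%:M -> cj S' = - S' -> denom S Z \in unitmx ->
  cj (Phi S' (cj (Phi S Z))) = Z.
Proof. by move=> S'S cS' uM; rewrite cj_Phi// cjK; exact: Phi_invK. Qed.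

End Isometry.

Theorem theorem2p9 (R : realType) (n : nat) (S : 'M[R[i]]_(n + n)) :
  (1 <= n)%N -> symplectic S -> purely_imaginary S ->
  (forall Z : 'M[R[i]]_n, siegel Z ->
     dlsubmx S *m Z + drsubmx S \in unitmx) /\
  isometry_between (@siegel R n) d_infty (@siegel_bar R n) d_minus (Phi S).
Proof.
move=> _ symS /cj_imaginary cS.
have uM Z : siegel Z -> denom S Z \in unitmx by exact: denom_unit.
split; first exact: uM.
have [S' S'S [symS' /(_ cS) cS']] := symplectic_inv symS.
have SS' := mulmx1C S'S.
split; first split.
- by move=> Z sZ; apply/siegel_barP; exact: siegel_cj_Phi.
- move=> Z1 Z2 /set_mem sZ1 /set_mem sZ2 eqPhi.
  by rewrite -(cj_PhiK S'S cS' (uM _ sZ1)) eqPhi cj_PhiK// uM.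
- move=> V /siegel_barP sV; exists (cj (Phi S' (cj V))).
    exact: siegel_cj_Phi.
  have := cj_PhiK SS' cS (denom_unit symS' cS' sV).
  by move/(congr1 (fun X : 'M[R[i]]_n => cj X)); rewrite !cjK.
(* The reverse inequality is the same one for the inverse of S. *)
move=> Z1 Z2 sZ1 sZ2; apply/eqP; rewrite eq_le d_infty_cj_Phi_le//=.
have K1 := cj_PhiK S'S cS' (uM _ sZ1); have K2 := cj_PhiK S'S cS' (uM _ sZ2).
rewrite -[X in (X <= _)%E](congr2 d_infty K1 K2).
exact: d_infty_cj_Phi_le symS' cS'.
Qed.
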